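(* Let $J$ be an ideal on $\omega$ that has a topological representation. If $J$ is analytic, then $J$ is $\mathbf{\Pi}^0_3$-complete. In particular, if the equivalence relation $E_J$ is analytic, then $E_J$ is $\mathbf{\Pi}^0_3$.
   Context: An ideal on a set $E$ is a family of subsets of $E$ closed under taking subsets and finite unions; it is always assumed to contain all singletons $\{s\}$, $s\in E$. Subsets of $\omega$ are identified with elements of $2^\omega$ via characteristic functions, and the descriptive complexity of an ideal on $\omega$ is its complexity as a subset of the Cantor space $2^\omega$. $E_J$ denotes the equivalence relation on $2^\omega$ given by $x\mathrel{E_J}y$ if and only if $x\,\Delta\, y\in J$ (symmetric difference, with $x,y$ regarded as subsets of $\omega$); its complexity is that of a subset of $2^\omega\times 2^\omega$. A $\sigma$-ideal on a set $X$ is a family of subsets of $X$ closed under taking subsets and countable unions, assumed to contain all singletons of $X$. Given a separable metrizable space $X$, a $\sigma$-ideal $I$ on $X$ and a countable dense set $D\subseteq X$, let $J_I=\{a\subseteq D:\mathrm{cl}(a)\in I\}$, where $\mathrm{cl}$ is closure in $X$. An ideal $J$ on a countable set $E$ has a topological representation if there are such $X$, $I$, $D$ and a bijection $\rho:E\to D$ with $J=\{a\subseteq E:\rho(a)\in J_I\}$, where $\rho(a)$ is the image of $a$.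
   Formalization: The completeness claim is stated for proper ideals J (ω not in J), since the improper ideal P(ω) has a topological representation and is analytic but is not Π⁰₃-complete; the claim about E_J is stated for all J. *)

(* Defs.v *)
From mathcomp Require Import all_boot all_order all_algebra.
From mathcomp Require Import all_classical all_reals all_analysis borel_hierarchy.

Set Implicit Arguments.
Unset Strict Implicit.
Unset Printing Implicit Defensive.

Local Open Scope classical_set_scope.

(* Properness (~ I setT) is not part of the definition. *)
Definition set_ideal (E : Type) (I : set (set E)) : Prop :=
  [/\ I set0,
      forall A B, A `<=` B -> I B -> I A,
      forall A B, I A -> I B -> I (A `|` B) &
      forall s, I [set s]].

Definition set_sigma_ideal (X : Type) (I : set (set X)) : Prop :=
  [/\ I set0,
      forall A B, A `<=` B -> I B -> I A,
      forall A : (set X)^nat, (forall n, I (A n)) -> I (\bigcup_n A n) &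
      forall s, I [set s]].

Definition separable (X : topologicalType) : Prop :=
  exists2 D : set X, countable D & dense D.

Definition ideal_of_closures (X : topologicalType) (I : set (set X))
    (D : set X) : set (set X) :=
  [set a | a `<=` D /\ I (closure a)].

(* Only the topology of X is used below: ranging over metric spaces amounts to
   ranging over metrizable spaces. *)
Definition has_topological_representation (R : realType) (E : Type)
    (J : set (set E)) : Prop :=
  exists (X : metricType R) (I : set (set X)) (D : set X) (rho : E -> X),
    [/\ separable X, set_sigma_ideal I, countable D /\ dense D,
        set_bij [set: E] D rho &
        J = [set a | ideal_of_closures I D (rho @` a)]].

Definition supp (x : cantor_space) : set nat := [set n | x n].

Definition in_cantor (J : set (set nat)) : set cantor_space :=
  [set x | J (supp x)].

Definition E_mod (J : set (set nat)) (x y : cantor_space) : Prop :=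
  J (supp x `+` supp y).

Definition graph_of (X Y : Type) (r : X -> Y -> Prop) : set (X * Y) :=
  [set xy | r xy.1 xy.2].

(* nat carries the discrete topology. *)
Definition baire_space : topologicalType := prod_topology (fun _ : nat => nat).

(* The empty set is not a continuous image of the Baire space. *)
Definition analytic (X : topologicalType) (A : set X) : Prop :=
  A = set0 \/ exists2 f : baire_space -> X, continuous f & A = range f.

(* In a metrizable space, the class Pi^0_3 consists of the F_sigma-delta
   sets. *)
Definition Pi03 (X : topologicalType) (A : set X) : Prop :=
  exists2 F : (set X)^nat, (forall n, Fsigma (F n)) & A = \bigcap_n F n.

Definition complete_metric (R : realType) (X : metricType R) : Prop :=
  forall u : nat -> X, cauchy (u @ \oo) -> exists l : X, u @ \oo --> l.

(* This is the existence of a basis of clopen sets; the library's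
   zero_dimensional only asks that clopen sets separate points, which is weaker
   for noncompact spaces. *)
Definition clopen_basis (X : topologicalType) : Prop :=
  forall (x : X) (U : set X), nbhs x U ->
    exists V : set X, [/\ clopen V, V x & V `<=` U].

Definition wadge_reducible (X Y : topologicalType) (B : set X) (A : set Y) :
    Prop :=
  exists2 f : X -> Y, continuous f & B = f @^-1` A.

(* A is Pi^0_3 and every Pi^0_3 subset of a zero-dimensional Polish space
   Wadge-reduces to it. *)
Definition Pi03_complete (R : realType) (Y : topologicalType) (A : set Y) :
    Prop :=
  Pi03 A /\
  forall X : metricType R,
    complete_metric X -> separable X -> clopen_basis X ->
    forall B : set X, Pi03 B -> wadge_reducible B A.

(* Main.v *)
(* Fix a countable base of X, pull it back along the enumeration of D to sets b m
   of natural numbers, and let Phi(a) record which b m are met by a.  Membership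
   in J depends only on Phi(a), and Phi-open sets are F_sigma in the Cantor space,
   so the upper bound amounts to J being a countable intersection of Phi-open
   sets.  The key closure property is that if sets L_n of J converge to a set a of
   J in the sense of Phi, then the union of a and all the L_n lies in J, its
   closure being the union of the closures.  Let f be a continuous map from the
   Baire space onto J.  If every set of J that is Phi-close to a is covered by the
   closure of some f(alpha) with alpha extending s, the key property yields a
   one-step extension s' of s with the same property for a smaller Phi-
   neighbourhood of a.  Iterating gives, for a in J, an infinite branch; and
   conversely an infinite branch alpha at a forces a to be covered by the closure
   of f(alpha), hence a to lie in J.

   For hardness, a point x0 none of whose neighbourhoods is in I has shrinking
   neighbourhoods U_n; in each U_n there are finite sets G_{n,k} of points of D such
   that the union over an infinite set of indices k is never in J.  Reducing each
   F_sigma set to the ideal of finite sets by a continuous h_n, the map sending x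
   to the union of the G_{n,k} over all n and all k in h_n(x) reduces the
   intersection of the F_sigma sets to J: if all rows are finite the union is a
   sequence converging to x0.

   E_J is the preimage of J under symmetric difference and J is its image. *)
Require Import Defs.
From mathcomp Require Import all_boot all_order all_algebra.
From mathcomp Require Import all_classical all_reals all_analysis borel_hierarchy.

Set Implicit Arguments.
Unset Strict Implicit.
Unset Printing Implicit Defensive.

Import Order.TTheory GRing.Theory Num.Theory.

Local Open Scope classical_set_scope.

(** * Countable bases, and closures of countable unions *)

Definition nat_base (T : topologicalType) (B : nat -> set T) : Prop :=
  (forall m, open (B m)) /\
  forall (x : T) (U : set T), nbhs x U -> exists2 m, B m x & B m `<=` U.

Lemma separable_nat_base (R : realType) (X : metricType R) :
  separable X -> exists B : nat -> set X, nat_base B.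
Proof.
move=> [D /countable_injP[g ginj] dD].
pose r (k : nat) : R := k.+1%:R^-1%R.
have r0 k : (0 < r k)%R by rewrite /r invr_gt0.
(* As [g] is injective on [D], the union has at most one member: the ball about the point of code
   [mk.1], if there is one. *)
pose C (mk : nat * nat) := \bigcup_(d in D `&` [set d | g d = mk.1])
   (ball d (r mk.2))°.
exists (fun p => if unpickle p is Some mk then C mk else set0); split.
  move=> p; case: unpickle => [mk|]; last exact: open0.
  by apply: bigcup_open => d _; exact: open_interior.
move=> x U /nbhs_ballP[e /= e0 eU].
have [k _ rk] := @near_infty_natSinv_lt R (PosNum (divr_gt0 e0 (ltr0n R 2))).
have {}rk : (r k < e / 2)%R by apply: rk => /=.
have rk2 : (0 < r k / 2)%R by rewrite divr_gt0.
have [d [xd Dd]] : (ball x (r k / 2))° `&` D !=set0.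
  apply: dD; last exact: open_interior.
  by exists x; apply: nbhsx_ballx.
have {xd} xd := interior_subset xd.
exists (pickle (g d, k)); rewrite pickleK.
  exists d => //=; apply: (@filterS _ _ _ (ball x (r k / 2))) => [y xy|].
    by rewrite [r k]splitr; apply: ball_triangle xy; apply: ball_sym.
  exact: nbhsx_ballx.
move=> y [d' /= [Dd' gd'] /interior_subset dy]; apply: eU.
have -> : e = (e / 2 + e / 2)%R by rewrite -splitr.
have d'E : d' = d by apply: ginj; rewrite ?inE.
rewrite {}d'E in dy.
apply: (@ball_triangle _ _ d).
  apply: le_ball xd; rewrite (le_trans _ (ltW rk))// ler_pdivrMr//.
  by rewrite ler_peMr ?ltW// (ltr_nat R 1 2).
exact: le_ball (ltW rk) _ dy.
Qed.

Lemma nat_base_closureP (T : topologicalType) (B : nat -> set T) (A : set T)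
    (x : T) : nat_base B ->
  closure A x <-> forall m, B m x -> A `&` B m !=set0.
Proof.
move=> [oB nB]; split=> [cA m Bx|AB U /nB[m Bx BU]].
  by apply: cA; apply: open_nbhs_nbhs.
by have [y [Ay /BU Uy]] := AB m Bx; exists y.
Qed.

Lemma near_ltn (T : Type) (F : set_system T) (P : nat -> set T) (N : nat) :
  Filter F -> (forall n, \forall x \near F, P n x) ->
  \forall x \near F, forall n, (n < N)%N -> P n x.
Proof.
move=> FF FP; have := @filter_forall _ 'I_N (fun i => P i) F FF (fun i => FP i).
by apply: filterS => x Px n nN; exact: (Px (Ordinal nN)).
Qed.

Lemma not_closure_near (T : topologicalType) (A : set T) (x : T) :
  ~ closure A x -> \forall y \near x, ~ A y.
Proof.
move=> nA; apply: contrapT => nx; apply: nA => U Ux; apply: contrapT => nU.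
by apply: nx; apply: filterS Ux => y Uy Ay; apply: nU; exists y.
Qed.

(* The hypothesis says that every cluster point of the sequence of sets [L n]
   lies in [K]. *)
Lemma closure_bigcup_cluster (T : topologicalType) (K : set T)
    (L : nat -> set T) :
  (forall x, ~ K x ->
    exists N, \forall y \near x, forall n, (N <= n)%N -> ~ L n y) ->
  closure (\bigcup_n L n) `<=` K `|` \bigcup_n closure (L n).
Proof.
move=> KL x clx; have [|/KL[N LN]] := pselect (K x); first by left.
right; apply: contrapT => nclx.
(* Near [x] only the finitely many [L n] with [n < N] can have points, and [x] is outside the
   closure of each of them. *)
have /(_ N) LltN : forall M, \forall y \near x, forall n, (n < M)%N -> ~ L n y.
  move=> M; apply: near_ltn => n; apply: not_closure_near => cn.
  by apply: nclx; exists n.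
have [y [[n _ Ly] [yltN yN]]] := clx _ (filterI LltN LN).
by have [/yltN|/yN] := ltnP n N.
Qed.

(** * Convergence and continuity in the Baire and Cantor spaces *)

Lemma baire_space_cvg (u : nat -> baire_space) (alpha : baire_space) :
  (forall i k, (i < k)%N -> u k i = alpha i) -> u @ \oo --> alpha.
Proof.
move=> ualpha; apply/cvg_sup => i U [V] [[W] oW <-] /= Walpha VU.
apply: filterS VU _; exists i.+1 => // k /= ik.
by rewrite /= ualpha.
Qed.

Lemma cantor_coord_near (x : cantor_space) (i : nat) :
  \forall y \near x, y i = x i.
Proof.
exact: (@proj_continuous nat (fun=> bool) i x [set x i] (discrete_set1 _)).
Qed.

Lemma continuous_cantor (T : topologicalType) (g : T -> cantor_space) :
  (forall x i, \forall y \near x, g y i = g x i) -> continuous g.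
Proof.
move=> gloc x; apply/cvg_sup => i U [V] [[W] oW <-] /= Wgx VU.
by apply: filterS VU _; apply: filterS (gloc x i) => y gy; rewrite /= gy.
Qed.

Lemma closed_cantor_coord (i : nat) (v : bool) :
  closed [set x : cantor_space | x i = v].
Proof.
have := @preimage_closed cantor_space bool (@proj nat (fun=> bool) i) [set v].
apply; last exact: discrete_closed.
by move=> x _; exact: proj_continuous.
Qed.

(** * The upper bound for an analytic ideal *)

Section Analytic_to_Pi03.
Context (b : nat -> set nat).

(* [c] is contained in the closure of [a] for the topology with base [b]. *)
Definition covered (c a : set nat) : Prop :=
  forall m, c `&` b m !=set0 -> a `&` b m !=set0.

Definition agree (N : nat) (a c : set nat) : Prop :=
  forall m, (m < N)%N -> (a `&` b m !=set0) = (c `&` b m !=set0).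

(* [j = 0] says that [a] misses [b m], and [j = i.+1] that [i] is a common
   point. *)
Definition witness (m : nat) (a : set nat) (j : nat) : Prop :=
  if j is i.+1 then a i /\ b m i else a `&` b m = set0.

Lemma witness_ex (m : nat) (a : set nat) : exists j, witness m a j.
Proof.
have [[i [ai bi]]|nab] := pselect (a `&` b m !=set0); first by exists i.+1.
by exists 0; apply/eqP; apply/negPn/negP => /set0P.
Qed.

Lemma witness_meets (m : nat) (a c : set nat) (j : nat) :
  witness m a j -> witness m c j -> (a `&` b m !=set0) = (c `&` b m !=set0).
Proof.
case: j => /= [-> -> //|i [ai bi] [ci _]].
by apply/propext; split=> _; exists i.
Qed.

Lemma closed_witness (m j : nat) :
  closed [set x : cantor_space | witness m (supp x) j].
Proof.
case: j => [|i] /=.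
  have -> : [set x : cantor_space | supp x `&` b m = set0] =
      \bigcap_(i in b m) [set x : cantor_space | x i = false].
    apply/seteqP; split=> [x /= xb i bi|x /= xb].
      by apply/negbTE/negP => xi; rewrite -[False]/(set0 i) -xb.
    by rewrite -subset0 => i [/= xi /xb /=]; move: xi; rewrite /supp /= => ->.
  by apply: closed_bigI => i _; exact: closed_cantor_coord.
have [bi|nbi] := pselect (b m i).
  rewrite (_ : [set _ | _] = [set x : cantor_space | x i = true]).
    exact: closed_cantor_coord.
  by apply/seteqP; split=> [x []|x].
rewrite (_ : [set _ | _] = set0); first exact: closed0.
by rewrite -subset0 => x [].
Qed.

(** Missing [b m] is a closed condition, but meeting it is only open. Naming a common point makes it
    closed, at the price of a countable union over finite sequences [w] of witnesses. *)
Lemma agree_open_Fsigma (S : set (set nat)) :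
  (forall a, S a -> exists N, forall c, agree N a c -> S c) ->
  Fsigma (in_cantor S).
Proof.
move=> openS.
pose C (w : seq nat) : set cantor_space :=
  [set x | forall m, (m < size w)%N -> witness m (supp x) (nth 0 w m)].
have closedC w : closed (C w).
  rewrite (_ : C w = \bigcap_(m in [set m | (m < size w)%N])
      [set x : cantor_space | witness m (supp x) (nth 0 w m)]) //.
  by apply: closed_bigI => m _; exact: closed_witness.
exists (fun n => if unpickle n is Some w then
    if `[< C w `<=` in_cantor S >] then C w else set0 else set0).
  by move=> n; case: unpickle => [w|]; [case: asboolP|] => *;
    [exact: closedC|exact: closed0|exact: closed0].
apply/seteqP; split=> [x Sx|x [n _]]; last first.
  by case: unpickle => // w; case: asboolP => // CS /CS.
have [N SN] := openS _ Sx.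
have [w xw] := choice (fun m => witness_ex m (supp x)).
exists (pickle (mkseq w N)) => //; rewrite pickleK; case: asboolP => [_|nCS].
  by move=> m; rewrite size_mkseq => mN; rewrite nth_mkseq.
exfalso; apply: nCS => y Cy; apply: SN => m mN.
have := Cy m; rewrite size_mkseq nth_mkseq// => /(_ mN).
exact: witness_meets.
Qed.

Context (J : set (set nat)) (f : baire_space -> cantor_space).

(* The second components of [gamma] make [Phi (f alpha)], where [alpha] is its
   sequence of first components, depend continuously on [gamma]; [Phi \o f] alone
   is not continuous. *)
Definition traced (gamma : nat -> nat * nat) : Prop :=
  forall m, witness m (supp (f (fun i => (gamma i).1))) (gamma m).2.

Definition dominated (s : seq (nat * nat)) (c : set nat) : Prop :=
  exists gamma : nat -> nat * nat, [/\ traced gamma,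
    mkseq gamma (size s) = s & covered c (supp (f (fun i => (gamma i).1)))].

(** The second conjunct keeps the first from holding vacuously: [run_branch] draws from it traced
    sequences through [s]. *)
Definition good (s : seq (nat * nat)) (N : nat) (a : set nat) : Prop :=
  (forall c, J c -> agree N a c -> dominated s c) /\
  exists2 c, J c & agree N a c.

(* Taking the least [M], and a value of [p] that depends only on the set of
   admissible ones, makes a successful step depend only on the agreement class of
   [a] at level [M]; at a dead end the state is left unchanged, so that the size of
   the sequence tells whether the run has got stuck. *)
Definition next (a : set nat) (sN : seq (nat * nat) * nat) :
    seq (nat * nat) * nat :=
  if pselect (exists M,
    `[< (sN.2 < M)%N /\ exists p, good (rcons sN.1 p) M a >]) is left exM
  then let M := ex_minn exM in
    (rcons sN.1 (xget (0, 0) [set p | good (rcons sN.1 p) M a]), M)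
  else sN.

Definition run (a : set nat) (k : nat) : seq (nat * nat) * nat :=
  iter k (next a) ([::], 0).

Lemma agreeW (M N : nat) (a c : set nat) :
  (M <= N)%N -> agree N a c -> agree M a c.
Proof. by move=> MN ac m mM; apply: ac; exact: leq_trans MN. Qed.

Lemma good_agree (s : seq (nat * nat)) (N : nat) (a c : set nat) :
  agree N a c -> good s N a = good s N c.
Proof.
move=> ac; apply/propext; rewrite /good.
have acE d : agree N a d <-> agree N c d.
  by split=> h m mN; rewrite -h// ac.
split=> -[h [d Jd /acE ad]]; split; try by exists d.
  by move=> e Je /acE; exact: h.
by move=> e Je /acE; exact: h.
Qed.

Lemma next_cases (a : set nat) (s : seq (nat * nat)) (N : nat) :
  (next a (s, N) = (s, N) /\
   forall M p, (N < M)%N -> ~ good (rcons s p) M a) \/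
  (exists M p, [/\ next a (s, N) = (rcons s p, M), (N < M)%N &
    good (rcons s p) M a]).
Proof.
rewrite /next /=; case: pselect => [exM|nexM]; [right|left]; last first.
  split=> // M p NM gM; apply: nexM; exists M; apply/asboolP.
  by split=> //; exists p.
case: ex_minnP => M /asboolP[NM gM] _; exists M; eexists; split=> //.
by case: gM => p gp; apply: (@xgetI _ (0, 0) [set p | good (rcons s p) M a] p).
Qed.

(** Goodness at levels up to [M] does not distinguish [a] from [c], so both have the same least
    level and the same candidates [p]. *)
Lemma next_agree (a c : set nat) (s t : seq (nat * nat)) (N M : nat) :
  next a (s, N) = (t, M) -> (size s < size t)%N -> agree M a c ->
  next c (s, N) = (t, M).
Proof.
rewrite /next /=; case: pselect => [exM|_]; last first.
  by case=> -> _; rewrite ltnn.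
case: ex_minnP => M0 /asboolP[NM gM] minM [<- M0E] _; subst M0 => ac.
have exc : exists M, `[< (N < M)%N /\ exists p, good (rcons s p) M c >].
  exists M; apply/asboolP; split=> //; case: gM => p gp; exists p.
  by rewrite -(good_agree _ ac).
case: pselect => // exM'.
case: ex_minnP => M' /asboolP[NM' gM'] minM'.
have M'M : (M' <= M)%N.
  apply: minM'; apply/asboolP; split=> //; case: gM => p gp; exists p.
  by rewrite -(good_agree _ ac).
have MM' : (M <= M')%N.
  apply: minM; apply/asboolP; split=> //; case: gM' => p gp; exists p.
  by rewrite (good_agree _ (agreeW M'M ac)).
have -> : M' = M by apply/eqP; rewrite eqn_leq M'M.
congr (rcons s _, M); congr (xget _ _); apply/funext => p /=.
by rewrite (good_agree _ ac).
Qed.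

Lemma run_size (a : set nat) (k : nat) : (size (run a k).1 <= k)%N.
Proof.
elim: k => [//|k IHk]; rewrite /run iterS -/(run a k).
case: (run a k) IHk => s N /= IHk.
have [[-> _]|[M [p [-> _ _]]]] := next_cases a s N; first exact: leqW.
by rewrite size_rcons.
Qed.

Lemma run_full_pred (a : set nat) (k : nat) : size (run a k.+1).1 = k.+1 ->
  exists p, [/\ size (run a k).1 = k, (run a k.+1).1 = rcons (run a k).1 p,
    ((run a k).2 < (run a k.+1).2)%N & good (run a k.+1).1 (run a k.+1).2 a].
Proof.
have := run_size a k; rewrite /run iterS -/(run a k).
case: (run a k) => s N /= sk.
have [[-> _] /= sk1|[M [p [-> NM gM]]]] := next_cases a s N.
  by rewrite sk1 ltnn in sk.
by rewrite size_rcons => -[->]; exists p.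
Qed.

(** Levels increase along a run that is not stuck, so agreement at the last level includes agreement
    at all earlier ones. *)
Lemma run_agree (a c : set nat) (k : nat) : size (run a k).1 = k ->
  agree (run a k).2 a c -> run c k = run a k.
Proof.
elim: k => [//|k IHk] sk ac; have [p [sk' tE NM _]] := run_full_pred sk.
have {}IHk : run c k = run a k by apply: IHk => //; apply: agreeW (ltnW NM) ac.
rewrite /run iterS -/(run c k) IHk.
move: tE ac; rewrite /run iterS -/(run a k).
case E : (run a k) => [s N]; case E' : (next a (s, N)) => [t M] /= tE ac.
by apply: next_agree E' _ ac; rewrite tE size_rcons.
Qed.

Hypothesis Jf : forall a, J a <-> exists alpha, supp (f alpha) = a.
Hypothesis fcont : continuous f.
Hypothesis J0 : J set0.
Hypothesis Jcov : forall a c, J a -> covered c a -> J c.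
Hypothesis Jcvg : forall (a : set nat) (L : nat -> set nat),
  J a -> (forall n, J (L n)) ->
  (forall m, a `&` b m = set0 ->
    exists N, forall n, (N <= n)%N -> L n `&` b m = set0) ->
  J (a `|` \bigcup_n L n).

Lemma good_nil (a : set nat) : good [::] 0 a.
Proof.
split; last by exists set0.
move=> c /Jf[alpha fa] _.
have [w cw] := choice (fun m => witness_ex m c).
exists (fun i => (alpha i, w i)).
by rewrite /traced /= fa; split.
Qed.

(** Otherwise each pair has a counterexample in [J], the [n]-th one agreeing with [a] beyond level
    [n]. Their union with [a] is then in [J], and some [gamma] through [s] dominates it; this
    [gamma] also dominates the counterexample to its own next entry. *)
Lemma good_step (a : set nat) (s : seq (nat * nat)) (N : nat) :
  J a -> good s N a ->
  exists M p, (N < M)%N /\ good (rcons s p) M a.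
Proof.
move=> Ja [gs _]; apply: contrapT => nex.
have H n : exists c, [/\ J c, agree (N + n).+1 a c &
    ~ dominated (rcons s (odflt (0, 0) (unpickle n))) c].
  apply: contrapT => nc; apply: nex; exists (N + n).+1.
  exists (odflt (0, 0) (unpickle n)); split; first by rewrite ltnS leq_addr.
  split; last by exists a.
  by move=> c Jc ac; apply: contrapT => dc; apply: nc; exists c.
have [L LP] := choice H.
pose c := a `|` \bigcup_n L n.
have Jc : J c.
  apply: Jcvg => // [n|m am]; first by have [] := LP n.
  exists m => n mn; apply/eqP/negPn/negP => /set0P Lm.
  have [_ aL _] := LP n; move: Lm; rewrite -aL; last first.
    by rewrite ltnS (leq_trans mn)// leq_addl.
  by rewrite am => -[].
have ac : agree N a c.
  move=> m mN; apply/propext; split=> [[i [ai bi]]|[i [[ai|[n _ Li]] bi]]].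
  - by exists i; split=> //; left.
  - by exists i.
  - have [_ -> //] := LP n; last first.
      by rewrite ltnS ltnW// (leq_trans mN)// leq_addr.
    by exists i.
have [gamma [tg sg cg]] := gs _ Jc ac.
have [_ _] := LP (pickle (gamma (size s))); rewrite pickleK /=; apply.
exists gamma; split=> //.
  by rewrite size_rcons mkseqS sg.
move=> m [i [Li bi]]; apply: cg; exists i; split=> //.
by right; eexists; [|exact: Li].
Qed.

Lemma run_full (a : set nat) (k : nat) : J a -> size (run a k).1 = k.
Proof.
move=> Ja; suff [] : size (run a k).1 = k /\ good (run a k).1 (run a k).2 a by [].
elim: k => [|k [sk gk]]; first by split=> //; exact: good_nil.
rewrite /run iterS -/(run a k); case: (run a k) sk gk => s N /= sk gk.
have [[_ nM]|[M [p [-> _ gp]]]] := next_cases a s N.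
  by have [M [p [/nM nMp /nMp]]] := good_step Ja gk.
by rewrite size_rcons sk.
Qed.

(** Sequences through ever longer initial segments of [gamma] cover sets agreeing ever longer with
    [a]. If [a] meets [b m], the trace entry at [m] names one point of [b m] common to all late
    [f (u k)]; by continuity it stays in the limit [f alpha]. *)
Lemma run_branch (a : set nat) : (forall k, size (run a k).1 = k) -> J a.
Proof.
move=> sk; pose gamma i := nth (0, 0) (run a i.+1).1 i.
have gammaE k : mkseq gamma k = (run a k).1.
  elim: k => [//|k IHk]; have [p [sk' tE _ _]] := run_full_pred (sk k.+1).
  by rewrite mkseqS IHk tE /gamma tE nth_rcons sk' ltnn eqxx.
have lek k : (k <= (run a k).2)%N.
  elim: k => [//|k IHk]; have [p [_ _ + _]] := run_full_pred (sk k.+1).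
  exact: leq_ltn_trans.
have H k : exists cg : set nat * (nat -> nat * nat), [/\ agree k.+1 a cg.1,
    traced cg.2, mkseq cg.2 k.+1 = mkseq gamma k.+1 &
    covered cg.1 (supp (f (fun i => (cg.2 i).1)))].
  have [p [_ _ _ [gk [c Jc ac]]]] := run_full_pred (sk k.+1).
  have [g [tg gE cg]] := gk _ Jc ac.
  exists (c, g); split=> //=; first exact: agreeW (lek _) ac.
  by rewrite gammaE -[RHS]gE sk.
have {H}[cg cgP] := choice H.
have cgE k m : (m <= k)%N -> (cg k).2 m = gamma m.
  move=> mk; have [_ _ + _] := cgP k => /(congr1 (nth (0, 0) ^~ m)).
  by rewrite !nth_mkseq.
apply: (@Jcov (supp (f (fun i => (gamma i).1)))).
  by apply/Jf; eexists.
move=> m abm.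
have wk k : (m <= k)%N -> exists i, [/\ (gamma m).2 = i.+1,
    supp (f (fun i => ((cg k).2 i).1)) i & b m i].
  move=> mk; have [ac tg _ cc] := cgP k; have := tg m; rewrite cgE//.
  have : supp (f (fun i => ((cg k).2 i).1)) `&` b m !=set0.
    by apply: cc; rewrite -ac.
  case: (gamma m).2 => [/= [i /[swap] ->]//|i _ /= [fi bi]].
  by exists i.
have [i [gmi _ bi]] := wk m (leqnn m).
exists i; split=> //.
pose u k : baire_space := fun i => ((cg k).2 i).1.
pose alpha : baire_space := fun i => (gamma i).1.
have cvgu : u @ \oo --> alpha.
  by apply: baire_space_cvg => j k jk; rewrite /u cgE// ltnW.
have cvgfu : f (u k) @[k --> \oo] --> f alpha.
  exact: (cvg_trans (cvg_app f cvgu) (@fcont alpha)).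
apply: (closed_cvg _ (@closed_cantor_coord i true) _ _ cvgfu).
exists m => // k /= mk.
by have [j [+ fj _]] := wk k mk; rewrite gmi => -[->].
Qed.

Lemma Pi03_in_cantor : Pi03 (in_cantor J).
Proof.
exists (fun k => in_cantor [set a | size (run a k).1 = k]).
  move=> k; apply: agree_open_Fsigma => a /= sa; exists (run a k).2 => c ac.
  by rewrite (run_agree sa ac).
apply/seteqP; split=> [x Jx k _|x Jx]; first exact: run_full.
by apply: run_branch => k; exact: Jx.
Qed.

End Analytic_to_Pi03.

(** * Continuous preimages and images, and the relation of the ideal to [E_mod] *)

Lemma preimage_Pi03 (T U : topologicalType) (g : T -> U) (A : set U) :
  continuous g -> Pi03 A -> Pi03 (g @^-1` A).
Proof.
move=> gc [F FF ->]; exists (fun n => g @^-1` (F n)); last exact: preimage_bigcap.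
move=> n; have [C cC ->] := FF n; exists (fun k => g @^-1` (C k)).
  by move=> k; apply: preimage_closed (cC k) => x _; exact: gc.
exact: preimage_bigcup.
Qed.

Lemma image_analytic (T U : topologicalType) (g : T -> U) (A : set T) :
  continuous g -> analytic A -> analytic (g @` A).
Proof.
move=> gc [->|[f fc ->]]; first by left; rewrite image_set0.
right; exists (g \o f); last by rewrite image_comp.
by move=> x; apply: continuous_comp; [exact: fc|exact: gc].
Qed.

Definition symdiff (xy : cantor_space * cantor_space) : cantor_space :=
  fun n => xy.1 n (+) xy.2 n.

Lemma supp_symdiff (x y : cantor_space) :
  supp (symdiff (x, y)) = supp x `+` supp y.
Proof.
apply/seteqP; split=> n; rewrite /supp /symdiff /= /setY /setD /=.
  by case: (x n); case: (y n) => // _; [left|right].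
by case: (x n); case: (y n) => //; case=> -[].
Qed.

Lemma continuous_symdiff : continuous symdiff.
Proof.
apply: continuous_cantor => -[x y] i.
have nx : \forall z \near (x, y), z.1 i = x i.
  exact: (@cvg_fst _ _ (nbhs x) (nbhs y) _ _ (cantor_coord_near x i)).
have ny : \forall z \near (x, y), z.2 i = y i.
  exact: (@cvg_snd _ _ (nbhs x) (nbhs y) _ _ (cantor_coord_near y i)).
by apply: filterS2 nx ny => -[x' y'] /= xE yE; rewrite /symdiff /= xE yE.
Qed.

Lemma graph_E_mod (J : set (set nat)) :
  graph_of (E_mod J) = symdiff @^-1` in_cantor J.
Proof.
apply/seteqP.
by split=> -[x y]; rewrite /graph_of /E_mod /in_cantor /= supp_symdiff.
Qed.

Lemma image_graph_E_mod (J : set (set nat)) :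
  symdiff @` graph_of (E_mod J) = in_cantor J.
Proof.
rewrite graph_E_mod; apply/seteqP; split=> [_ [xy Jxy <-]//|x Jx].
have xE : symdiff (x, fun=> false) = x.
  by apply/funext => n; rewrite /symdiff /= addbF.
by exists (x, fun=> false) => //=; rewrite xE.
Qed.

(** * Reduction of F_sigma sets to the ideal of finite sets *)

Lemma open_disjoint_clopen (T : topologicalType) (B : nat -> set T)
    (U : set T) : nat_base B -> clopen_basis T -> open U ->
  exists W : nat -> set T,
    [/\ forall i, clopen (W i), trivIset setT W & U = \bigcup_i W i].
Proof.
move=> [_ nB] cT oU.
(* Base sets need not be clopen, so a clopen set between [B i] and [U] is chosen whenever there is
   one. *)
have H i : exists V, [/\ clopen V, V `<=` U &
    (exists2 V', clopen V' & B i `<=` V' /\ V' `<=` U) -> B i `<=` V].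
  have [[V cV [BV VU]]|nV] :=
    pselect (exists2 V', clopen V' & B i `<=` V' /\ V' `<=` U).
    by exists V.
  by exists set0; split=> //; exact: clopen0.
have [V VP] := choice H.
exists (seqDU V); split; last 1 first.
- rewrite -seqDU_bigcup_eq; apply/seteqP; split=> [x Ux|x [i _ Vx]]; last first.
    by have [_ + _] := VP i; apply.
  have [W [cW Wx WU]] := cT x U (open_nbhs_nbhs (conj oU Ux)).
  have [i Bx BW] := nB x W (open_nbhs_nbhs (conj cW.1 Wx)).
  by exists i => //; have [_ _] := VP i; apply=> //; exists W.
- move=> i; apply: clopenI; first by have [] := VP i.
  apply: (clopenC set0); apply: (big_ind (@clopen T)) => [||j _].
  + exact: clopen0.
  + exact: clopenU.
  + by have [] := VP j.
- exact: trivIset_seqDU.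
Qed.

Lemma Fsigma_reduces_finite (T : topologicalType) (B : nat -> set T)
    (F : set T) : nat_base B -> clopen_basis T -> Fsigma F ->
  exists2 h : T -> cantor_space, continuous h &
    forall x, F x <-> finite_set (supp (h x)).
Proof.
move=> bB cT [C cC ->].
have H j : exists W : nat -> set T, [/\ forall i, clopen (W i),
    trivIset setT W & ~` (\bigcup_(k in `I_j.+1) C k) = \bigcup_i W i].
  apply: open_disjoint_clopen bB cT _; apply: closed_openC.
  exact: closed_bigcup.
have [W WP] := choice H.
(* Each [x] lies in at most one [W j i] for each [j], so [supp (h x)] is in
   bijection with the set of [j] such that [x] avoids [C 0], ..., [C j]. *)
pose h x : cantor_space := fun n =>
  if pickle_inv n is Some ji then `[< W ji.1 ji.2 x >] else false.
exists h.
  apply: continuous_cantor => x n; rewrite /h.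
  case: pickle_inv => [[j i]/=|]; last exact: nearW.
  have [/(_ i)[oW cW] _ _] := WP j.
  have [Wx|nWx] := pselect (W j i x).
    have : nbhs x (W j i) by exact: open_nbhs_nbhs.
    by apply: filterS => y Wy; rewrite !asboolT.
  have : nbhs x (~` W j i) by apply: open_nbhs_nbhs; split=> //; exact: closed_openC.
  by apply: filterS => y Wy; rewrite !asboolF.
move=> x; split=> [[k _ Ckx]|].
  pose e j := pickle (j, xget 0 [set i | W j i x]).
  apply: sub_finite_set (finite_image e (finite_II k)).
  move=> n; rewrite /supp /= /h => hn.
  have {hn} [[j i] nE /asboolP Wx] : exists2 ji, pickle_inv n = Some ji &
      `[< W ji.1 ji.2 x >] by move: hn; case: pickle_inv => // ji; exists ji.
  have [_ tW UW] := WP j.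
  exists j => /=.
    rewrite ltnNge; apply/negP => kj.
    have : (\bigcup_i W j i) x by exists i.
    by rewrite -UW; apply; exists k.
  rewrite /e; have -> : xget 0 [set i | W j i x] = i.
    by case: xgetP => [i' _ Wi'|/(_ i)//]; apply: tW => //; exists x.
  by have := @pickle_invK (nat * nat)%type n; rewrite nE.
apply: contraPP => nF fin.
apply: infinite_nat.
apply: sub_finite_set (finite_image
  (fun n => if pickle_inv n is Some ji then (ji : nat * nat).1 else 0) fin) => j _.
have [_ _ UW] := WP j.
have : (~` (\bigcup_(k in `I_j.+1) C k)) x.
  by move=> [k _ Ck]; apply: nF; exists k.
rewrite UW => -[i _ Wx]; exists (pickle (j, i)); last by rewrite /= pickleK_inv.
by rewrite /supp /= /h pickleK_inv; apply/asboolP.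
Qed.

(** * Represented ideals and their closure properties *)

Lemma ideal_finite (E : eqType) (J : set (set E)) (a : set E) :
  set_ideal J -> finite_set a -> J a.
Proof.
move=> [J0 JS JU J1] /finite_seqP[s ->] {a}; elim: s => [|e s IHs].
  by apply: JS J0 => e.
apply: JS (JU _ _ (J1 e) IHs) => d; rewrite /= inE.
by move=> /orP[/eqP->|]; [left|right].
Qed.

Lemma sigma_idealU (X : Type) (I : set (set X)) (A B : set X) :
  set_sigma_ideal I -> I A -> I B -> I (A `|` B).
Proof.
move=> [I0 _ IU _] IA IB; rewrite -bigcup2E; apply: IU => -[|[|n]] //.
Qed.

Lemma infinite_nat_ge (a : set nat) (N : nat) :
  infinite_set a -> exists2 n, a n & (N <= n)%N.
Proof.
move=> /infinite_setD /(_ (finite_II N)) /infinite_setN0[n [an /negP]].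
by rewrite -leqNgt; exists n.
Qed.

Definition indic (a : set nat) : cantor_space := fun n => `[< a n >].

Lemma supp_indic (a : set nat) : supp (indic a) = a.
Proof. by apply/funext => n; apply/propext; split=> /asboolP. Qed.

Section Represented_ideal.
Context (R : realType) (X : metricType R) (I : set (set X)) (D : set X)
  (rho : nat -> X) (B : nat -> set X) (J : set (set nat)).
Hypothesis sI : set_sigma_ideal I.
Hypothesis dD : dense D.
Hypothesis rhoD : set_bij [set: nat] D rho.
Hypothesis bB : nat_base B.
Hypothesis JE : forall a, J a <-> I (closure (rho @` a)).
Hypothesis hJ : set_ideal J.

Let b (m : nat) : set nat := rho @^-1` B m.

Lemma meets_image (a : set nat) (m : nat) :
  (rho @` a `&` B m !=set0) <-> (a `&` b m !=set0).
Proof.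
split=> [[_ [[i ai <-] Bi]]|[i [ai Bi]]]; first by exists i.
by exists (rho i); split=> //; exists i.
Qed.

Lemma represented_covered (a c : set nat) : J a -> covered b c a -> J c.
Proof.
case: sI => _ IS _ _ /JE Ja ca; apply/JE; apply: IS Ja => x.
rewrite !(nat_base_closureP _ _ bB) => cx m Bx.
by apply/meets_image/ca/meets_image; exact: cx.
Qed.

(** A point outside the closure of the image of [a] has a basic neighbourhood missing that image,
    hence missing the images of all late [L n]; so the union creates no new cluster points. *)
Lemma represented_bigcup (a : set nat) (L : nat -> set nat) :
  J a -> (forall n, J (L n)) ->
  (forall m, a `&` b m = set0 ->
    exists N, forall n, (N <= n)%N -> L n `&` b m = set0) ->
  J (a `|` \bigcup_n L n).
Proof.
case: (sI) => _ IS IU _ /JE Ja JL aL; apply/JE.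
rewrite image_setU closureU; apply: (IS) (sigma_idealU sI Ja
    (IU _ (fun n => (JE _).1 (JL n)))) => x [ax|]; first by left.
rewrite image_bigcup; apply: closure_bigcup_cluster => y nay.
have [m By Bna] := bB.2 y _ (not_closure_near nay).
have abm : a `&` b m = set0.
  by rewrite -subset0 => i [ai /Bna]; apply; exists i.
have [N LN] := aL m abm; exists N.
apply: filterS (open_nbhs_nbhs (conj (bB.1 m) By)) => z Bz n Nn [i Li iz].
by rewrite -[False]/(set0 i) -(LN n Nn); split=> //; rewrite /b /= iz.
Qed.

Lemma represented_Pi03 : analytic (in_cantor J) -> Pi03 (in_cantor J).
Proof.
have J0 : J set0 by case: hJ.
move=> [J0E|[f fc fJ]].
  have : in_cantor J (indic set0) by rewrite /in_cantor /= supp_indic.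
  by rewrite J0E.
apply: (@Pi03_in_cantor b J f) => //.
- move=> a; split=> [Ja|[alpha <-]].
    have : in_cantor J (indic a) by rewrite /in_cantor /= supp_indic.
    by rewrite fJ => -[alpha _ fx]; exists alpha; rewrite fx supp_indic.
  have : range f (f alpha) by exists alpha.
  by rewrite -fJ.
- exact: represented_covered.
- exact: represented_bigcup.
Qed.

(** * Hardness of a proper represented ideal *)

Hypothesis nJT : ~ J [set: nat].

(** Otherwise the basic open sets in [I], being countably many, would put [X] itself in [I]. *)
Lemma nowhere_ideal_point : exists x : X, forall U, nbhs x U -> ~ I U.
Proof.
case: (sI) => I0 IS IU _; apply: contrapT => nx; apply: nJT; apply/JE.
have : I (\bigcup_m if `[< I (B m) >] then B m else set0).
  by apply: IU => m; case: asboolP.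
apply: (IS) => x _; apply: contrapT => nBx; apply: nx; exists x => U Ux IU'.
have [m Bx BU] := bB.2 x U Ux; apply: nBx; exists m => //.
by rewrite asboolT//; exact: IS BU IU'.
Qed.

(* If infinitely many of the finite sets [G k] below were contained in a set in
   [J], then its closure together with the countably many basic open sets in [I]
   would cover the interior of [U]: a basic open subset of [U] containing only
   finitely many points of [D] lies in [I]. *)
Lemma finite_sets_dense_in (U : set X) (N : nat) : ~ I U° ->
  exists G : nat -> set nat, [/\
    forall k d, G k d -> (N + k <= d)%N,
    forall k d, G k d -> U (rho d),
    forall k, finite_set (G k) &
    forall S, infinite_set S -> ~ J (\bigcup_(k in S) G k)].
Proof.
case: (sI) => I0 IS IU _ nIU.
pose E i := [set d | B i (rho d) /\ U (rho d)].
(* The lower bound [N + k] serves the continuity of the reduction in [represented_hard]. *)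
pose p k i := xget 0 [set d | E i d /\ (N + k <= d)%N].
have pP k i : infinite_set (E i) -> E i (p k i) /\ (N + k <= p k i)%N.
  move=> /(infinite_nat_ge (N + k))[d Ed Nd].
  exact: (@xgetI _ 0 [set d | E i d /\ (N + k <= d)%N] d).
exists (fun k => p k @` [set i | (i <= k)%N /\ infinite_set (E i)]); split.
- by move=> k _ [i [_ /(pP k)[]] _ ? <-].
- by move=> k _ [i [_ /(pP k)[[]]] _ ? _ <-].
- move=> k; apply: finite_image; apply: sub_finite_set (finite_II k.+1).
  by move=> i [].
move=> S infS; set a := \bigcup_(k in S) _ => /JE Ia; apply: nIU.
have IB : I (\bigcup_m if `[< I (B m) >] then B m else set0).
  by apply: IU => m; case: asboolP.
apply: (IS _ _ _ (sigma_idealU sI Ia IB)) => y Uy.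
have [|ncy] := pselect (closure (rho @` a) y); first by left.
right; have [i Bi BiU] := bB.2 y _ (filterI Uy (not_closure_near ncy)).
have BU : B i `<=` U by move=> z /BiU[].
exists i => //; rewrite asboolT//.
(* If [E i] were infinite, any [k] in [S] with [i <= k] would put a point of [a] into [B i]. *)
have finE : finite_set (E i).
  apply: contrapT => infE; have [k Sk ik] := infinite_nat_ge i infS.
  have [[Bp _] _] := pP k i infE.
  have [_] := BiU _ Bp; apply; exists (p k i) => //.
  by exists k => //; exists i.
have /JE := ideal_finite hJ finE; apply: IS => z Bz V Vz.
have BV : nbhs z (B i `&` V).
  by apply: filterI => //; apply: open_nbhs_nbhs; split=> //; exact: bB.1.
have [w [/interior_subset[Bw Vw] Dw]] : (B i `&` V)° `&` D !=set0.
  by apply: dD; [exists z|exact: open_interior].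
have [_ _ /(_ w Dw)[d _ dw]] := rhoD.
exists w; split=> //; exists d => //; rewrite /E /= dw; split=> //.
exact: BU.
Qed.

Lemma represented_hard (T : topologicalType) (C : nat -> set T) (A : set T) :
  nat_base C -> clopen_basis T -> Pi03 A -> wadge_reducible A (in_cantor J).
Proof.
move=> bC cT [F FF ->]; case: (sI) => I0 IS IU I1.
have [h hP] := choice (fun n => (exists2P _ _).1 (Fsigma_reduces_finite bC cT (FF n))).
have [x0 x0P] := nowhere_ideal_point.
pose U n := [set y | forall m, (m < n)%N -> B m x0 -> B m y].
have Ux0 n : nbhs x0 (U n).
  apply: near_ltn => m; have [Bm|nBm] := pselect (B m x0).
    by apply: filterS (open_nbhs_nbhs (conj (bB.1 m) Bm)).
  exact: nearW.
(* Some [B m] around [x0] misses a neighbourhood of [y], and [U n] lies in [B m] as soon as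
   [m < n]. *)
have Ucvg y : y <> x0 -> exists N, \forall z \near y, forall n, (N <= n)%N -> ~ U n z.
  move=> /eqP; have := @metric_hausdorff _ X; rewrite open_hausdorff => hX.
  move=> /hX[[P Q] /= [/set_mem Py /set_mem Qx] [oP oQ /eqP PQ0]].
  have [m Bx BQ] := bB.2 x0 Q (open_nbhs_nbhs (conj oQ Qx)).
  exists m.+1; apply: filterS (open_nbhs_nbhs (conj oP Py)) => z Pz n mn Uz.
  by rewrite -[False]/(set0 z) -PQ0; split=> //; apply: BQ; exact: Uz.
have [G GP] := choice (fun n => finite_sets_dense_in n (x0P _ (nbhs_interior (Ux0 n)))).
pose a x := \bigcup_n \bigcup_(k in supp (h n x)) G n k.
exists (fun x => indic (a x)).
  apply: continuous_cantor => x d.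
  (* Since [G n k] has no elements below [n + k], finitely many values of the [h n] decide
     coordinate [d]. *)
  have : \forall y \near x, forall n, (n < d.+1)%N -> forall k, (k < d.+1)%N -> h n y k = h n x k.
    apply: near_ltn => n; apply: near_ltn => k.
    exact: ((hP n).1 x _ (cantor_coord_near _ k)).
  apply: filterS => y yx; apply/asbool_equiv_eq.
  have Gd n k : G n k d -> (n < d.+1)%N /\ (k < d.+1)%N.
    have [Gle _ _ _] := GP n => /Gle nkd; rewrite !ltnS.
    by split; apply: leq_trans nkd; rewrite ?leq_addr ?leq_addl.
  split=> -[n _ [k hk Gk]]; exists n => //; exists k => //; move: hk;
    have [nd kd] := Gd _ _ Gk; by rewrite /supp /= yx.
apply/seteqP; split=> x; rewrite /in_cantor /= supp_indic.
  move=> Fx; apply/JE.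
  have row n : J (\bigcup_(k in supp (h n x)) G n k).
    apply: ideal_finite hJ _; apply: bigcup_finite; first exact/(hP n).2/Fx.
    by move=> k _; have [] := GP n.
  have rowU n : rho @` (\bigcup_(k in supp (h n x)) G n k) `<=` U n.
    by move=> _ [d [k _ Gd] <-]; have [_ + _ _] := GP n; apply; exact: Gd.
  apply: (IS) (sigma_idealU sI (I1 x0) (IU _ (fun n => (JE _).1 (row n)))).
  rewrite /a image_bigcup; apply: closure_bigcup_cluster => y /Ucvg[N yN].
  by exists N; apply: filterS yN => z zN n Nn /rowU; exact: zN.
move=> Ja n _; apply/(hP n).2; apply: contrapT => infS.
have [_ _ _ /(_ _ infS)] := GP n; apply.
by case: hJ => _ JS _ _; apply: JS Ja => d; exists n.
Qed.

End Represented_ideal.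

Theorem theorem1p4 (R : realType) (J : set (set nat))
  (hJ : set_ideal J) (hrep : has_topological_representation R J) :
  (analytic (in_cantor J) -> ~ J [set: nat] -> Pi03_complete R (in_cantor J)) /\
  (analytic (graph_of (E_mod J)) -> Pi03 (graph_of (E_mod J))).
Proof.
have [X [I [D [rho [sX sI [_ dD] rhoD JE]]]]] := hrep.
have {}JE a : J a <-> I (closure (rho @` a)).
  rewrite JE; split=> [[]//|Ia]; split=> // _ [n _ <-].
  by have [+ _ _] := rhoD; apply.
have [B bB] := separable_nat_base sX.
split=> [aJ nJT|aE].
  split; first exact: represented_Pi03 bB JE hJ aJ.
  move=> Y _ /separable_nat_base[C bC] cY A.
  exact: (represented_hard sI dD rhoD bB JE hJ nJT bC cY).
rewrite graph_E_mod; apply: preimage_Pi03; first exact: continuous_symdiff.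
apply: represented_Pi03 bB JE hJ _ => //.
by rewrite -image_graph_E_mod; apply: image_analytic aE; exact: continuous_symdiff.
Qed.
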